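(* Let $n\geq d+1\geq 3$ be integers, let $C$ be a set of $n$ distinct points on the moment curve $(\tau,\tau^2,\dots,\tau^d)$, $-\infty<\tau<\infty$, in $\mathbb{E}^d$, and let $\mathbf{C}(n,d)=\mathrm{conv}(C)$ be the corresponding cyclic polytope, with $c_i(n,d)$ its number of $i$-dimensional faces. If $r>0$ is such that $\mathbf{P}_{C,r}=\bigcap_{\mathbf{c}\in C}\mathbf{B}^d[\mathbf{c},r]$ is a basic $r$-ball polyhedron with center-polytope $\mathbf{C}(n,d)$, then the number $f_{k-1}(\mathbf{P}_{C,r})$ of its $(k-1)$-dimensional faces satisfies $$f_{k-1}(\mathbf{P}_{C,r})=c_{d-k}(n,d)\quad\text{for all } 0\leq k-1\leq d-1.$$
   Context: $\mathbb{E}^d$ ($d>1$) is $d$-dimensional Euclidean space; $\mathbf{B}^d[\mathbf{p},r]$ and $\mathbf{B}^d(\mathbf{p},r)$ are the closed and open balls of radius $r$ centered at $\mathbf{p}$. Farthest point Voronoi diagram: for a finite set $C=\{\mathbf{c}_1,\dots,\mathbf{c}_n\}\subset\mathbb{E}^d$ of $n>1$ distinct points, put $R_f(\mathbf{x}):=\{\mathbf{c}_i\in C : \|\mathbf{x}-\mathbf{c}_i\|\geq\|\mathbf{x}-\mathbf{c}_j\| \text{ for all } 1\leq j\leq n\}$. The farthest point Voronoi diagram $V_f(C)$ is the partition of $\mathbb{E}^d$ into the nonempty sets $V_S:=R_f^{-1}(S)=\{\mathbf{x}: R_f(\mathbf{x})=S\}$, $S\subseteq C$; these sets are the faces of $V_f(C)$.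 The closure of each face is a convex polyhedral set; the dimension of a face is the dimension of its affine hull, and $0$-dimensional faces are called vertices. $r$-convex position: the points of $C$ lie in $r$-convex position if $C\subset\mathbf{B}^d(\mathbf{p},r)$ for some $\mathbf{p}\in\mathbb{E}^d$ and $\mathbf{c}_i\notin\mathrm{conv}_r(C\setminus\{\mathbf{c}_i\})$ for all $i$, where $\mathrm{conv}_r(X):=\bigcap\{\mathbf{B}^d[\mathbf{x},r] : X\subset\mathbf{B}^d[\mathbf{x},r]\}$. Basic $r$-ball polyhedron: let $\mathbf{C}=\mathrm{conv}(C)$ be a $d$-dimensional convex polytope with vertex set $C=\{\mathbf{c}_1,\dots,\mathbf{c}_n\}$, $n\geq d+1\geq 3$, and let $\mathbf{P}_{C,r}:=\bigcap_{i=1}^n\mathbf{B}^d[\mathbf{c}_i,r]$. If $r>0$ is such that the points of $C$ lie in $r$-convex position and every vertex of $V_f(C)$ belongs to $\mathrm{int}(\mathbf{P}_{C,r})$, then $\mathbf{P}_{C,r}$ is called a ($d$-dimensional) basic $r$-ball polyhedron with center-polytope $\mathbf{C}$. For $1\leq k\leq d$, if $V_S$ is a $k$-dimensional face of $V_f(C)$ with $V_S\cap\mathrm{bd}(\mathbf{P}_{C,r})\neq\emptyset$, then $V_S\cap\mathrm{bd}(\mathbf{P}_{C,r})$ is called a $(k-1)$-dimensional face of $\mathbf{P}_{C,r}$. *)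

(* Defs.v *)
From HB Require Import structures.
From mathcomp Require Import all_boot all_order all_algebra finmap.
From mathcomp Require Import all_classical all_reals all_analysis.

Set Implicit Arguments.
Unset Strict Implicit.
Unset Printing Implicit Defensive.

Import Order.TTheory GRing.Theory Num.Theory.
Import numFieldNormedType.Exports.

Local Open Scope classical_set_scope.
Local Open Scope ring_scope.

(* E^d is 'rV[R]_d.  The library norm on matrices is the sup norm, so the
   Euclidean norm and its balls are defined here; the library topology is the
   product topology, which is the Euclidean one, so interior and closure are
   the library notions. *)

Section Euclidean.
Variables (R : realType) (d : nat).
Implicit Types (x y u : 'rV[R]_d) (X A F : set 'rV[R]_d) (r : R).

Definition dotv x y : R := \sum_(i < d) x 0 i * y 0 i.

Definition enorm x : R := Num.sqrt (dotv x x).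

Definition eball x r : set 'rV[R]_d := [set y | enorm (y - x) < r].

Definition eclosed_ball x r : set 'rV[R]_d := [set y | enorm (y - x) <= r].

Definition bd X : set 'rV[R]_d := closure X `\` X°.

Definition convex_hull X : set 'rV[R]_d := smallest (@convex_set R 'rV[R]_d) X.

Definition affine_hull X : set 'rV[R]_d :=
  [set y | exists m (p : 'I_m -> 'rV[R]_d) (a : 'I_m -> R),
    [/\ forall i, X (p i), \sum_(i < m) a i = 1
      & y = \sum_(i < m) a i *: p i]].

(* The empty set has no dimension in this sense. *)
Definition has_dim X (k : nat) : Prop :=
  exists x (U : {vspace 'rV[R]_d}),
    affine_hull X = [set x + u | u in [set` U]] /\ \dim U = k.

(* Faces as intersections with the hyperplane of a valid inequality; u = 0
   yields the improper faces, the polytope itself and the empty set. *)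
Definition polytope_face A F : Prop :=
  exists u (b : R), (forall x, A x -> dotv u x <= b)
    /\ F = A `&` [set x | dotv u x = b].

Definition polytope_faces A (i : nat) : set (set 'rV[R]_d) :=
  [set F | polytope_face A F /\ has_dim F i].

Definition polytope_vertices A : set 'rV[R]_d :=
  [set v | polytope_face A [set v]].

End Euclidean.

Section FarthestVoronoi.
Variables (R : realType) (d : nat).
Implicit Types (x : 'rV[R]_d) (C S : set 'rV[R]_d).

Definition farthest C x : set 'rV[R]_d :=
  [set c | C c /\ forall c', C c' -> enorm (x - c') <= enorm (x - c)].

Definition Voronoi_cell C S : set 'rV[R]_d := [set x | farthest C x = S].

Definition Voronoi_face C (V : set 'rV[R]_d) : Prop :=
  exists S, [/\ S `<=` C, V = Voronoi_cell C S & V !=set0].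

End FarthestVoronoi.

Section BallPolyhedra.
Variables (R : realType) (d : nat).
Implicit Types (C X : set 'rV[R]_d) (r : R).

Definition conv_r r X : set 'rV[R]_d :=
  \bigcap_(x in [set x | X `<=` eclosed_ball x r]) eclosed_ball x r.

Definition r_convex_position r C : Prop :=
  (exists p, C `<=` eball p r) /\
  forall c, C c -> ~ conv_r r (C `\ c) c.

Definition ball_polyhedron C r : set 'rV[R]_d :=
  \bigcap_(c in C) eclosed_ball c r.

(* The center-polytope is convex_hull C. *)
Definition basic_ball_polyhedron C r : Prop :=
  [/\ finite_set C, has_dim (convex_hull C) d,
      polytope_vertices (convex_hull C) = C,
      0 < r /\ r_convex_position r C
    & forall V, Voronoi_face C V -> has_dim V 0 ->
        V `<=` (ball_polyhedron C r)°].

(* The j-dimensional faces, cut out by the (j+1)-dimensional Voronoi faces. *)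
Definition ball_polyhedron_faces C r (j : nat) : set (set 'rV[R]_d) :=
  [set F | exists V, [/\ Voronoi_face C V, has_dim V j.+1,
      F = V `&` bd (ball_polyhedron C r) & F !=set0]].

End BallPolyhedra.

Definition moment_curve (R : realType) (d : nat) (t : R) : 'rV[R]_d :=
  \row_(i < d) t ^+ i.+1.

(* fset_set is the empty set on infinite sets, so this is a cardinality only
   for finite families. *)
Definition num_of (T : choiceType) (A : set T) : nat := #|` fset_set A|%fset.

(* Main.v *)
Require Import Defs.
From mathcomp Require Import all_boot all_order all_algebra finmap.
From mathcomp Require Import all_classical all_reals all_analysis.
From mathcomp Require Import ring lra zify.

(** Up to the term |x|^2, the maximum over c in C of |x - c|^2 is a maximum of
    affine functions of x.  Hence from a point x one can move along a direction v
    orthogonal to the differences of the farthest points of x until a new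
    farthest point appears, unless v attains its minimum over C on all the
    present ones.  Choosing the sign of v so that the farthest distance does not
    decrease, and using that it is less than r at the Voronoi vertices, one
    finds that the cells V_S meeting bd P are those for which S lies in a proper
    face of conv C.  No d + 1 points of the moment curve lie on a hyperplane, so
    the proper faces of conv C are simplices, and these sets S are exactly their
    vertex sets.  Since S is then affinely independent, dim V_S = d + 1 - |S|
    while dim (conv S) = |S| - 1, so that S |-> V_S `&` bd P and S |-> conv S
    match the (k-1)-faces of P with the (d-k)-faces of conv C. *)

Import Order.TTheory GRing.Theory Num.Theory.
Import numFieldNormedType.Exports.

Local Open Scope classical_set_scope.
Local Open Scope ring_scope.

(** * Inner product, squared distances and the interior of a ball polyhedron *)

Section InnerProduct.
Context {R : realType} {d : nat}.
Implicit Types (x y u v c : 'rV[R]_d) (t : R).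

Lemma dotvC x y : dotv x y = dotv y x.
Proof. by apply: eq_bigr => i _; rewrite mulrC. Qed.

Lemma dotvDl x y u : dotv (x + y) u = dotv x u + dotv y u.
Proof. by rewrite -big_split; apply: eq_bigr => i _; rewrite mxE mulrDl. Qed.

Lemma dotvZl t x y : dotv (t *: x) y = t * dotv x y.
Proof. by rewrite mulr_sumr; apply: eq_bigr => i _; rewrite mxE mulrA. Qed.

Lemma dotvDr x y u : dotv u (x + y) = dotv u x + dotv u y.
Proof. by rewrite !(dotvC u) dotvDl. Qed.

Lemma dotvZr t x y : dotv x (t *: y) = t * dotv x y.
Proof. by rewrite !(dotvC x) dotvZl. Qed.

Lemma dotvNl x y : dotv (- x) y = - dotv x y.
Proof. by rewrite -scaleN1r dotvZl mulN1r. Qed.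

Lemma dotvNr x y : dotv x (- y) = - dotv x y.
Proof. by rewrite !(dotvC x) dotvNl. Qed.

Lemma dot0v x : dotv 0 x = 0.
Proof. by rewrite -(scale0r 0) dotvZl mul0r. Qed.

Lemma dotv_sumr (I : Type) (s : seq I) (f : I -> 'rV[R]_d) u :
  dotv u (\sum_(i <- s) f i) = \sum_(i <- s) dotv u (f i).
Proof.
by elim/big_rec2: _ => [|i y1 y2 _ <-]; rewrite ?dotvDr // dotvC dot0v.
Qed.

Lemma dotvv_ge0 x : 0 <= dotv x x.
Proof. by apply: sumr_ge0 => i _; rewrite -expr2 sqr_ge0. Qed.

Lemma dotvv_eq0 x : (dotv x x == 0) = (x == 0).
Proof.
apply/eqP/eqP => [x0|->]; last exact: dot0v.
apply/rowP => i; rewrite mxE; apply/eqP; rewrite -sqrf_eq0 expr2.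
by apply/eqP; apply: (psumr_eq0P _ x0) => // j _; rewrite -expr2 sqr_ge0.
Qed.

Lemma dotvv_gt0 x : (0 < dotv x x) = (x != 0).
Proof. by rewrite lt_def dotvv_ge0 dotvv_eq0 andbT. Qed.

Definition sqdist x y : R := dotv (x - y) (x - y).

(** The quadratic term does not involve [c], so comparing the distances to two centers along a line
    amounts to comparing affine functions of [t]. *)
Lemma sqdistDZ x v c t : sqdist (x + t *: v) c =
  sqdist x c + 2 * t * (dotv v x - dotv v c) + t ^+ 2 * dotv v v.
Proof.
have -> : dotv v x - dotv v c = dotv v (x - c) by rewrite dotvDr dotvNr.
rewrite /sqdist addrAC; move: (x - c) => w.
by rewrite dotvDl !dotvDr !dotvZl !dotvZr (dotvC w v); ring.
Qed.

Lemma ler_enorm x y : (enorm x <= enorm y) = (dotv x x <= dotv y y).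
Proof. by rewrite ler_sqrt // dotvv_ge0. Qed.

Lemma farthestP (C : set 'rV[R]_d) x c :
  farthest C x c <-> C c /\ forall c', C c' -> sqdist x c' <= sqdist x c.
Proof. by split=> -[Cc far]; split=> // c' /far; rewrite ler_enorm. Qed.

Lemma ball_polyhedronP {C : set 'rV[R]_d} {r : R} x : 0 < r ->
  ball_polyhedron C r x <-> forall c, C c -> sqdist x c <= r ^+ 2.
Proof.
move=> r0; suff E c : eclosed_ball c r x <-> sqdist x c <= r ^+ 2.
  by split=> [Px c /Px/E|Px c /Px/E].
by rewrite /eclosed_ball /= -[leLHS]ger0_norm ?sqrtr_ge0 // -sqrtr_sqr
  -[r in _ <= r]ger0_norm ?(ltW r0) // -(sqrtr_sqr r) !ler_sqrt ?sqr_ge0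
  ?sqr_sqrtr ?dotvv_ge0.
Qed.

Lemma near_line {A : set 'rV[R]_d} {x} v : nbhs x A ->
  exists2 e : R, 0 < e & forall t, `|t| < e -> A (x + t *: v).
Proof.
move=> xA; have : (x + t *: v) @[t --> (0 : R)] --> x.
  rewrite -[x in _ --> x]addr0 -(scale0r v).
  by apply: cvgD; [exact: cvg_cst|apply: cvgZr_tmp; exact: cvg_id].
move=> /(_ _ xA) /nbhs_normP [e /= e0 eA]; exists e => // t te.
by apply: eA; rewrite /ball_ /= sub0r normrN.
Qed.

Lemma sqdist_continuous c : continuous (sqdist^~ c).
Proof.
move=> x.
apply: (@cvg_big _ _ _ _ _ add_continuous _ (nbhs x)) => i _.
have f : (y - c) 0 i @[y --> x] --> (x - c) 0 i.
  apply: (@cvg_comp _ _ _ (fun y => y - c) (fun y : 'rV[R]_d => y 0 i)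
    (nbhs x) (nbhs (x - c))).
    by apply: cvgB; [exact: cvg_id|exact: cvg_cst].
  exact: (@coord_continuous _ 1 d 0 i (x - c)).
by apply: cvgM.
Qed.

(** From a point at distance [r] from [c], any step directly away from [c] leaves the ball.
    Conversely, finitely many strict inequalities between continuous functions persist nearby. *)
Lemma interior_ball_polyhedron {C : set 'rV[R]_d} {r : R} x :
  finite_set C -> 0 < r ->
  (ball_polyhedron C r)° x <-> forall c, C c -> sqdist x c < r ^+ 2.
Proof.
move=> finC r0; split=> [xP c Cc|xP].
  have xc : sqdist x c <= r ^+ 2.
    exact: (ball_polyhedronP x r0).1 (interior_subset xP) c Cc.
  rewrite lt_neqAle xc andbT; apply/eqP => xr.
  have [e e0 /(_ (e / 2))] := near_line (x - c) xP.
  rewrite ger0_norm ?divr_ge0 ?ltW // ltr_pdivrMr ?ltr_pMr // ?ltr1n //.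
  move=> /(_ isT) /(ball_polyhedronP _ r0).1 /(_ _ Cc).
  rewrite sqdistDZ -dotvNr -dotvDr -/(sqdist x c) xr; apply/negP.
  rewrite -ltNge -addrA ltrDl; have e2 : 0 < e / 2 by rewrite divr_gt0.
  by rewrite addr_gt0 // !mulr_gt0 // exprn_gt0.
rewrite /interior /=.
apply: (@filterS _ _ _ (\bigcap_(c in C) [set y | sqdist y c < r ^+ 2])).
  move=> y yP; apply/(ball_polyhedronP _ r0) => c Cc; exact: ltW (yP c Cc).
have [X CE] := finite_fsetP.1 finC; rewrite CE; apply: filter_bigI => c cX.
have xc : sqdist x c < r ^+ 2 by apply: xP; rewrite CE.
exact: (cvgr_lt _ (sqdist_continuous c x) _ xc).
Qed.

End InnerProduct.

(** * Extrema over finite sets *)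

Section FiniteExtrema.
Context {R : realType} {T : eqType} {A : set T}.
Implicit Types (f g : T -> R).

Lemma finite_argmax f : finite_set A -> A !=set0 ->
  exists2 m, A m & forall a, A a -> f a <= f m.
Proof.
move=> /finite_seqP[s ->]; elim: s => [[]//|x s IHs _].
have [-> | s0] := eqVneq s [::].
  by exists x => [|a] /=; rewrite !inE // => /eqP->.
have [|m sm mP] := IHs.
  by case: s s0 {IHs} => // y s _; exists y; rewrite /= mem_head.
case: (leP (f x) (f m)) => xm.
  exists m => [|a]; rewrite /= inE ?sm ?orbT // => /orP[/eqP->//|].
  exact: mP.
exists x => [|a]; rewrite /= inE ?eqxx // => /orP[/eqP->//|/mP am].
exact: le_trans am (ltW xm).
Qed.

(** Tool for perturbations: it suffices that [l] exceeds every [- g a / f a]. *)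
Lemma finite_dominated f g : finite_set A -> (forall a, A a -> 0 < f a) ->
  exists2 l : R, 0 <= l & forall m a, l <= m -> A a -> 0 < m * f a + g a.
Proof.
move=> finA f0; have [->|A0] := eqVneq A set0; first by exists 0.
have {}A0 : A !=set0 by exact/set0P.
have [a0 Aa0 a0P] := finite_argmax (fun a => - g a / f a) finA A0.
exists (Num.max 0 (- g a0 / f a0) + 1) => [|m a lm Aa].
  by rewrite addr_ge0 // le_max lexx.
have : - g a / f a < m.
  apply: le_lt_trans (a0P a Aa) (lt_le_trans _ lm).
  by rewrite (le_lt_trans (y := Num.max 0 (- g a0 / f a0))) ?ltrDl //
    le_max lexx orbT.
by rewrite ltr_pdivrMr ?f0 //; lra.
Qed.

End FiniteExtrema.

(** * Moving a point until its set of farthest points grows *)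

Section FarthestPoints.
Context {R : realType} {d : nat}.
Implicit Types (x y u v c : 'rV[R]_d) (t r : R) (C S : set 'rV[R]_d).

Definition const_on S v := forall c c', S c -> S c' -> dotv v c = dotv v c'.

(** Dual form of: the differences of points of [S] span the space. Farthest sets with this property
    belong to Voronoi vertices. *)
Definition spanning S := forall v, const_on S v -> v = 0.

Lemma farthest_nonempty C x : finite_set C -> C !=set0 -> farthest C x !=set0.
Proof.
move=> finC C0; have [c Cc cP] := finite_argmax (sqdist x) finC C0.
by exists c; apply/farthestP.
Qed.

Lemma farthest_ind C (P : 'rV[R]_d -> Prop) : finite_set C ->
  (forall y, (forall y', farthest C y `<=` farthest C y' ->
     (exists2 c, farthest C y' c & ~ farthest C y c) -> P y') -> P y) ->
  forall y, P y.
Proof.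
move=> /finite_seqP[s0 C0] IH y.
(* The list covers the points of [C] that are not yet farthest; its length is the induction
   measure. *)
have : forall c, C c -> farthest C y c \/ c \in s0.
  by move=> c; rewrite {1}C0 => sc; right.
move: (leqnn (size s0)); move: {2}(size s0) => n; clear C0.
elim: n s0 y => [|n IHn] s y sn sP; apply: IH => y' yy' [c y'c nyc].
  have [|] := sP c y'c.1; first by move=> /nyc.
  by move: sn; rewrite leqn0 => /nilP->.
have cs : c \in s by have [/nyc|] := sP c y'c.1.
apply: (IHn (rem c s)) => [|a Ca].
  by rewrite size_rem //; case: s sn cs {sP} => // *; lia.
have [/yy'|sa] := sP a Ca; first by left.
have [->|ac] := eqVneq a c; first by left.
right; apply: contraLR sa => anr.
by rewrite (perm_mem (perm_to_rem cs)) inE negb_or ac.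
Qed.

(** Along [v] the present farthest points stay tied, while points with a smaller product with [v]
    gain on them. The step stops when the first of these catches up. *)
Lemma farthest_step C y v c0 c1 : finite_set C ->
  const_on (farthest C y) v -> farthest C y c0 -> C c1 ->
  dotv v c1 < dotv v c0 ->
  exists2 t, 0 < t &
    farthest C y `<=` farthest C (y + t *: v) /\
    exists2 c, farthest C (y + t *: v) c & ~ farthest C y c.
Proof.
move=> finC vC yc0 Cc1 c10; have [Cc0 c0P] := (farthestP C y c0).1 yc0.
pose A := C `&` [set c | dotv v c < dotv v c0].
(* [phi c] is the parameter at which [c] becomes as far as [c0]. *)
pose phi c := (sqdist y c0 - sqdist y c) / (2 * (dotv v c0 - dotv v c)).
have finA : finite_set A by apply: sub_finite_set finC => c [].
have [|m [Cm /= mc0] mP] := finite_argmax (fun c => - phi c) finA.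
  by exists c1.
have nym : ~ farthest C y m by move=> ym; move: mc0; rewrite (vC _ _ ym yc0) ltxx.
have phiE c : dotv v c < dotv v c0 ->
    phi c * (2 * (dotv v c0 - dotv v c)) = sqdist y c0 - sqdist y c.
  by move=> cc0; rewrite /phi mulfVK //; lra.
have phim : 0 < phi m.
  rewrite divr_gt0 //; last by lra.
  rewrite subr_gt0 lt_neqAle c0P // andbT; apply/eqP => ym; apply: nym.
  by apply/farthestP; split=> // c Cc; rewrite ym c0P.
have c0far c : C c -> sqdist (y + phi m *: v) c <= sqdist (y + phi m *: v) c0.
  move=> Cc; rewrite !sqdistDZ lerD2r.
  have [cc0|cc0] := ltP (dotv v c) (dotv v c0).
    have K0 : 0 <= 2 * (dotv v c0 - dotv v c) by lra.
    have := mP c (conj Cc cc0); rewrite lerN2 => /(ler_wpM2r K0).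
    rewrite phiE //; lra.
  have := c0P c Cc.
  have : 0 <= phi m * (dotv v c - dotv v c0) by apply: mulr_ge0; [exact: ltW|lra].
  lra.
exists (phi m) => //; split.
  move=> c yc; have [Cc cP] := (farthestP C y c).1 yc.
  apply/farthestP; split=> // c' /c0far; congr (_ <= _).
  rewrite !sqdistDZ (vC _ _ yc yc0); congr (_ + _ + _).
  by apply/eqP; rewrite eq_le cP // c0P.
exists m => //; apply/farthestP; split=> // c /c0far; congr (_ <= _).
by have := phiE m mc0; rewrite !sqdistDZ; lra.
Qed.

(** As long as the farthest set does not span, some nonzero [v] is constant on it but not on [C], so
    [v] or [- v] allows another step. *)
Lemma farthest_spanning C y : finite_set C -> C !=set0 -> spanning C ->
  exists2 y', farthest C y `<=` farthest C y' & spanning (farthest C y').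
Proof.
move=> finC C0 spC; elim/(@farthest_ind C): y => // y IH.
have [?|nsp] := pselect (spanning (farthest C y)); first by exists y.
have [v vC v0] : exists2 v, const_on (farthest C y) v & v <> 0.
  by apply: contra_notP nsp => H v vC; apply: contra_notP H => v0; exists v.
have [c0 yc0] := farthest_nonempty C y finC C0.
suff [w wC [c1 Cc1 w10]] : exists2 w, const_on (farthest C y) w &
    exists2 c1, C c1 & dotv w c1 < dotv w c0.
  have [t t0 [yy' ycy']] := farthest_step _ _ _ _ _ finC wC yc0 Cc1 w10.
  by have [y'' /(subset_trans yy') ? ?] := IH _ yy' ycy'; exists y''.
apply: contra_notP v0 => H; apply: spC.
suff E c : C c -> dotv v c = dotv v c0 by move=> c c' /E-> /E->.
move=> Cc; apply/eqP; rewrite eq_le; apply/andP; split; rewrite leNgt; apply/negP => lt.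
  apply: H; exists (- v); last by exists c => //; rewrite !dotvNl ltrN2.
  by move=> a b ya yb; rewrite !dotvNl (vC a b).
by apply: H; exists v => //; exists c.
Qed.

(** With the sign of [v] chosen so that [dotv v c0 <= dotv v y], the distance to [c0] does not
    decrease along [v]. Some distance thus stays at least [r], which rules out a spanning farthest
    set, so the walk can only end at a [v] minimal on the farthest points. *)
Lemma farthest_sub_argmin C r y : finite_set C -> C !=set0 ->
  (forall y', spanning (farthest C y') ->
     forall c, C c -> sqdist y' c < r ^+ 2) ->
  (exists2 c, C c & r ^+ 2 <= sqdist y c) ->
  exists2 v, v != 0 & forall c c', farthest C y c -> C c' -> dotv v c <= dotv v c'.
Proof.
move=> finC C0 vtx; elim/(@farthest_ind C): y => // y IH [c Cc rc].
have nsp : ~ spanning (farthest C y).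
  by move=> /vtx/(_ c Cc); rewrite ltNge rc.
have [c0 yc0] := farthest_nonempty C y finC C0.
have [v [vC v0 vy]] : exists v, [/\ const_on (farthest C y) v, v <> 0 &
    0 <= dotv v y - dotv v c0].
  have [v vC v0] : exists2 v, const_on (farthest C y) v & v <> 0.
    by apply: contra_notP nsp => H v vC; apply: contra_notP H => v0; exists v.
  have [vy|vy] := leP 0 (dotv v y - dotv v c0); first by exists v.
  exists (- v); split.
  - by move=> a b ya yb; rewrite !dotvNl (vC a b).
  - by move=> /eqP; rewrite oppr_eq0 => /eqP.
  - by rewrite !dotvNl; lra.
have [[c1 Cc1 c10]|H] := pselect (exists2 c1, C c1 & dotv v c1 < dotv v c0).
  have [t t0 [yy' ycy']] := farthest_step _ _ _ _ _ finC vC yc0 Cc1 c10.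
  have [|w w0 wP] := IH _ yy' ycy'.
    exists c0; first exact: yc0.1.
    apply: le_trans rc (le_trans (((farthestP C y c0).1 yc0).2 c Cc) _).
    rewrite sqdistDZ -addrA lerDl addr_ge0 //.
      by rewrite !mulr_ge0 // ltW.
    by rewrite mulr_ge0 ?sqr_ge0 ?dotvv_ge0.
  by exists w => // a b /yy'; exact: wP.
exists v; first exact/eqP.
move=> a b ya Cb; rewrite (vC _ _ ya yc0) leNgt; apply/negP => lt.
by apply: H; exists b.
Qed.

End FarthestPoints.

(** * Affine dimension, convex hulls and affine independence *)

Section Dimension.
Context {R : realType} {d : nat}.
Implicit Types (x y u v w c : 'rV[R]_d) (t r b : R) (A C S X : set 'rV[R]_d).

Lemma has_dimI X x (U : {vspace 'rV[R]_d}) : X x ->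
  (forall z, X z -> z - x \in U) ->
  (forall u, u \in U -> affine_hull X (x + u)) -> has_dim X (\dim U).
Proof.
move=> Xx XU UX; exists x, U; split=> //; apply/seteqP; split=> z; last first.
  by case=> u uU <-; exact: UX.
move=> [m [p [a [Xp a1 ->]]]]; exists (\sum_i a i *: (p i - x)).
  by apply: memv_suml => i _; rewrite memvZ // XU.
under eq_bigr do rewrite scalerBr.
by rewrite sumrB -scaler_suml a1 scale1r addrC subrK.
Qed.

Lemma has_dim_inj X k k' : has_dim X k -> has_dim X k' -> k = k'.
Proof.
move=> [x [U [XU <-]]] [x' [U' [XU' <-]]].
have E : [set x + u | u in [set` U]] = [set x' + u | u in [set` U']].
  by rewrite -XU XU'.
suff aux a a' (W W' : {vspace 'rV[R]_d}) :
    [set a + u | u in [set` W]] = [set a' + u | u in [set` W']] -> (W <= W')%VS.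
  by congr (\dim _); apply/eqP; rewrite eqEsubv (aux _ _ _ _ E) (aux _ _ _ _ (esym E)).
move=> EW; apply/subvP => u uW.
have [v vW' av] : [set a' + u | u in [set` W']] (a + u) by rewrite -EW; exists u.
have [v' v'W' av'] : [set a' + u | u in [set` W']] a.
  by rewrite -EW; exists 0; rewrite /= ?mem0v ?addr0.
by rewrite -[u](addKr a) -av -{1}av' opprD addrACA addNr add0r addrC rpredB.
Qed.

Lemma affine_hull2 X x y t : X x -> X y -> affine_hull X (x + t *: (y - x)).
Proof.
move=> Xx Xy; exists 2%N, (fun i => if i == 0 then x else y),
  (fun i => if i == 0 then 1 - t else t); split.
- by move=> i; case: ifP.
- by rewrite !big_ord_recl big_ord0 /= addr0 subrK.
- rewrite !big_ord_recl big_ord0 /= addr0 scalerBl scale1r scalerBr.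
  by rewrite -addrA [_ - t *: x]addrC.
Qed.

Lemma convex_setI A :
  (forall x y t, 0 < t -> t < 1 -> A x -> A y -> A (t *: x + (1 - t) *: y)) ->
  @convex_set R 'rV[R]_d A.
Proof.
move=> cA; apply/convex_setW => x y xA yA k k0 k1; rewrite inE.
by apply: cA => //; rewrite -inE.
Qed.

Lemma convex_hull_convex X x y t : 0 <= t <= 1 -> convex_hull X x ->
  convex_hull X y -> convex_hull X (t *: x + (1 - t) *: y).
Proof.
move=> /andP[t0 t1] Xx Xy M [cM XM]; pose k := Itv01 t0 t1.
have /set_mem := cM x y k (mem_set (Xx M (conj cM XM))) (mem_set (Xy M (conj cM XM))).
by [].
Qed.

Lemma convex_hull_le X u b : (forall c, X c -> dotv u c <= b) ->
  forall x, convex_hull X x -> dotv u x <= b.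
Proof.
move=> Xb; apply: smallest_sub => //; apply: convex_setI => x y t t0 t1 /= xb yb.
have := ler_wpM2l (ltW t0) xb.
have t1' : 0 <= 1 - t by rewrite subr_ge0 ltW.
by have := ler_wpM2l t1' yb; rewrite dotvDr !dotvZr; lra.
Qed.

Lemma convex_hull_eq X u b : (forall c, X c -> dotv u c = b) ->
  forall x, convex_hull X x -> dotv u x = b.
Proof.
move=> Xb x Xx; apply/eqP; rewrite eq_le (@convex_hull_le X) //=; last first.
  by move=> c /Xb->.
rewrite -lerN2 -dotvNl (@convex_hull_le X) // => c /Xb <-.
by rewrite dotvNl.
Qed.

Lemma convex_hull_face X u b : (forall c, X c -> dotv u c <= b) ->
  convex_hull X `&` [set x | dotv u x = b] =
  convex_hull (X `&` [set x | dotv u x = b]).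
Proof.
move=> Xb; set F := X `&` _; apply/seteqP; split=> [x [Xx xb]|x Fx].
  (* This set is convex: equality at a combination with positive weights forces equality at both
     ends. *)
  suff /(_ x Xx)[_] : convex_hull X `<=`
    [set x | dotv u x <= b /\ (dotv u x = b -> convex_hull F x)] by apply.
  apply: smallest_sub => [|c Xc]; last first.
    by split=> [|cb]; [exact: Xb|apply: sub_gen_smallest].
  apply: convex_setI => {x Xx xb} x y t t0 t1 [xb xF] [yb yF].
  have t1' : 0 < 1 - t by rewrite subr_gt0.
  have tx := ler_wpM2l (ltW t0) xb; have ty := ler_wpM2l (ltW t1') yb.
  rewrite /= dotvDr !dotvZr; split=> [|E]; first lra.
  apply: convex_hull_convex; first by rewrite !ltW.
    apply: xF; apply: (mulfI (lt0r_neq0 t0)); lra.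
  apply: yF; apply: (mulfI (lt0r_neq0 t1')); lra.
split; last by apply: (@convex_hull_eq F) Fx => c [].
move: x Fx; apply: smallest_sub => [|c [Xc _]]; last exact: sub_gen_smallest.
by apply: convex_setI => x y t t0 t1; apply: convex_hull_convex; rewrite !ltW.
Qed.

(** A functional constant on [X] is constant on the affine hull of [convex_hull X], which is the
    whole space, so it vanishes. *)
Lemma spanning_of_full_dim X : has_dim (convex_hull X) d -> spanning X.
Proof.
move=> [x [U [XU dU]]] v vX.
have Ufull : U = fullv.
  by apply/eqP; rewrite eqEdim subvf dimvf dU dim_matrix mul1r leqnn.
have all y : affine_hull (convex_hull X) y.
  rewrite XU; exists (y - x); first by rewrite Ufull /= memvf.
  by rewrite addrC subrK.
have [b Xb] : exists b, forall c, X c -> dotv v c = b.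
  have [->|/set0P[c0 Xc0]] := eqVneq X set0; first by exists 0.
  by exists (dotv v c0) => c Xc; exact: vX.
have vb y : dotv v y = b.
  have [m [p [a [Xp a1 ->]]]] := all y; rewrite dotv_sumr.
  under eq_bigr do rewrite dotvZr (@convex_hull_eq X v b) //.
  by rewrite -mulr_suml a1 mul1r.
by apply/eqP; rewrite -dotvv_eq0 vb -(vb 0) dotvC dot0v.
Qed.

(* Affine independence in dual form, by the existence of barycentric
   coordinate functionals. *)
Definition aff_indep S := forall c, S c -> exists w b,
  dotv w c = b + 1 /\ forall c', S c' -> c' <> c -> dotv w c' = b.

(** The barycentric functional of a point other than [c0] takes its base value [b] at [c0], so these
    functionals form a dual family to the differences with [c0]. *)
Lemma aff_indep_dual S c0 (s : seq 'rV[R]_d) :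
  S = [set` c0 :: s] -> uniq (c0 :: s) -> aff_indep S ->
  exists w : nat -> 'rV[R]_d, forall i j, (i < size s)%N -> (j < size s)%N ->
    dotv (w i) (s`_j - c0) = (i == j)%:R.
Proof.
move=> SE /= /andP[c0s us] iS.
suff /choice[w wP] : forall i, exists w, forall j, (i < size s)%N ->
    (j < size s)%N -> dotv w (s`_j - c0) = (i == j)%:R.
  by exists w => i j ? ?; exact: wP.
move=> i; have [il|//] := ltnP i (size s); last by exists 0.
have Sn j : (j < size s)%N -> S s`_j.
  by move=> jl; rewrite SE /= inE mem_nth ?orbT.
have [w [b [wi wb]]] := iS _ (Sn i il); exists w => j _ jl.
have -> : dotv w (s`_j - c0) = dotv w s`_j - b.
  rewrite dotvDr dotvNr (wb c0) //; first by rewrite SE /= mem_head.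
  by move=> E; move: c0s; rewrite E mem_nth.
have [<-|ij] := eqVneq i j; first by rewrite wi addrC addKr.
rewrite wb ?subrr //; first exact: Sn.
by apply/eqP; rewrite nth_uniq // eq_sym.
Qed.

(** The dual family makes the map from [v] to its products with the [e j] surjective; [U] is its
    kernel, and rank-nullity gives the dimension. *)
Lemma annihilator_dim m (e w : nat -> 'rV[R]_d) :
  (forall i j, (i < m)%N -> (j < m)%N -> dotv (w i) (e j) = (i == j)%:R) ->
  exists2 U : {vspace 'rV[R]_d}, (\dim U + m)%N = d &
    forall v, v \in U <-> forall j, (j < m)%N -> dotv v (e j) = 0.
Proof.
move=> we; pose M := \matrix_(i < d, j < m) e j 0 i.
pose f := linfun (mulmxr M : 'rV[R]_d -> 'rV[R]_m).
have fE v (j : 'I_m) : f v 0 j = dotv v (e j).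
  by rewrite lfunE /= mxE; apply: eq_bigr => i _; rewrite mxE.
have imf : limg f = fullv.
  apply/eqP; rewrite eqEsubv subvf; apply/subvP => a _.
  apply/memv_imgP; exists (\sum_(i < m) a 0 i *: w i); first exact: memvf.
  apply/rowP => j; rewrite fE dotvC dotv_sumr (bigD1 j) //= big1 => [|i ij].
    by rewrite dotvZr dotvC we // eqxx mulr1 addr0.
  by rewrite dotvZr dotvC we // (negbTE (ij : val i != val j)) mulr0.
exists (lker f) => [|v].
  have := limg_ker_dim f fullv; rewrite capfv imf !dimvf !dim_matrix !mul1r.
  by [].
rewrite memv_ker; split=> [/eqP fv j jm|vP].
  by rewrite -(fE v (Ordinal jm)) fv mxE.
by apply/eqP/rowP => j; rewrite fE vP // mxE.
Qed.

Lemma convex_hull_dim c0 (s : seq 'rV[R]_d) : uniq (c0 :: s) ->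
  aff_indep [set` c0 :: s] -> has_dim (convex_hull [set` c0 :: s]) (size s).
Proof.
move=> us iS; have [w wP] := aff_indep_dual _ _ _ erefl us iS.
pose X := [tuple s`_i - c0 | i < size s].
have XE (i : 'I_(size s)) : X`_i = s`_i - c0 by rewrite -tnth_nth tnth_mktuple.
have fX : free X.
  apply/freeP => k k0 i; have : dotv (w i) (\sum_i k i *: X`_i) = 0.
    by rewrite k0 dotvC dot0v.
  rewrite dotv_sumr (bigD1 i) //= big1 => [|j ji].
    by rewrite XE dotvZr wP // eqxx mulr1 addr0.
  by rewrite XE dotvZr wP // eq_sym (negbTE (ji : val j != val i)) mulr0.
have <- : \dim <<X>> = size s by rewrite (eqP fX) size_tuple.
have Xc c : c \in c0 :: s -> c - c0 \in <<X>>%VS.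
  rewrite inE => /orP[/eqP->|cs]; first by rewrite subrr mem0v.
  have il : (index c s < size s)%N by rewrite index_mem.
  apply: memv_span; apply/tnthP; exists (Ordinal il).
  by rewrite tnth_mktuple /= nth_index.
apply: (@has_dimI _ c0).
- by apply: sub_gen_smallest; rewrite /= mem_head.
- apply: smallest_sub; last exact: Xc.
  apply: convex_setI => x y t _ _ /= xU yU.
  have -> : t *: x + (1 - t) *: y - c0 = t *: (x - c0) + (1 - t) *: (y - c0).
    by rewrite !scalerBr addrACA -opprD -scalerDl [t + _]addrC subrK scale1r.
  by rewrite rpredD // rpredZ.
- move=> u /coord_span ->; set a := fun i => coord X i u.
  (* Index 0 carries [c0], whose coefficient completes the sum to 1. *)
  exists (size s).+1, (fun i => (c0 :: s)`_i),
    (fun i => oapp a (1 - \sum_i a i) (unlift ord0 i)); split.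
  + by move=> i; apply: sub_gen_smallest; rewrite /= mem_nth.
  + rewrite big_ord_recl unlift_none /= [X in _ + X](eq_bigr a) ?subrK //.
    by move=> i _; rewrite liftK.
  + rewrite big_ord_recl unlift_none /=.
    rewrite [X in _ = _ + X](eq_bigr (fun i => a i *: s`_i)) => [|i _]; last first.
      by rewrite liftK.
    under eq_bigr do rewrite XE scalerBr.
    rewrite sumrB -scaler_suml scalerBl scale1r -addrA; congr (_ + _).
    by rewrite addrC.
Qed.

End Dimension.

(** * Voronoi cells and exposed subsets *)

Section VoronoiCells.
Context {R : realType} {d : nat}.
Implicit Types (x y z u v w c : 'rV[R]_d) (t r b : R) (A C F S X : set 'rV[R]_d).

Lemma farthest_sqdist_eq {C x c c'} :
  farthest C x c -> farthest C x c' -> sqdist x c = sqdist x c'.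
Proof.
move=> /farthestP[Cc cP] /farthestP[Cc' c'P].
by apply/eqP; rewrite eq_le cP // c'P.
Qed.

Lemma Voronoi_cellP C S c0 x : S `<=` C -> S c0 ->
  Voronoi_cell C S x <->
  (forall c, S c -> sqdist x c = sqdist x c0) /\
  (forall c, C c -> ~ S c -> sqdist x c < sqdist x c0).
Proof.
move=> SC Sc0; split=> [xS|[eqS ltS]].
  have xc0 : farthest C x c0 by rewrite xS.
  split=> c; first by rewrite -xS => xc; exact: farthest_sqdist_eq xc xc0.
  move=> Cc nSc; have [_ c0P] := (farthestP C x c0).1 xc0.
  rewrite lt_neqAle c0P // andbT; apply/eqP => E; apply: nSc; rewrite -xS.
  by apply/farthestP; split=> // c' Cc'; rewrite E c0P.
have leC c : C c -> sqdist x c <= sqdist x c0.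
  move=> Cc; have [/eqS->//|nSc] := pselect (S c).
  by apply: ltW; exact: ltS.
apply/seteqP; split=> c; last first.
  by move=> Sc; apply/farthestP; split=> [|c' Cc']; [exact: SC|rewrite (eqS c) ?leC].
move=> /farthestP[Cc cP]; have [//|nSc] := pselect (S c).
by have := ltS c Cc nSc; rewrite ltNge cP //; exact: SC.
Qed.

Lemma Voronoi_cell_diff {C x z} : farthest C z = farthest C x ->
  const_on (farthest C x) (z - x).
Proof.
move=> zx c c' xc xc'; have E := farthest_sqdist_eq xc xc'.
have := farthest_sqdist_eq (_ : farthest C z c) (_ : farthest C z c').
rewrite zx => /(_ xc xc'); rewrite -[z in sqdist z](subrK x) addrC.
by rewrite -(scale1r (z - x)) !sqdistDZ E !scale1r; lra.
Qed.

Lemma Voronoi_vertex_dim C x : spanning (farthest C x) ->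
  has_dim (Voronoi_cell C (farthest C x)) 0.
Proof.
move=> spx; rewrite -[0%N](dimv0 'rV[R]_d); apply: (@has_dimI _ _ _ x) => //.
  by move=> z /Voronoi_cell_diff/spx->; rewrite mem0v.
move=> u; rewrite memv0 => /eqP->.
by rewrite -(scale0r (x - x)); apply: affine_hull2.
Qed.

Lemma num_of_seq S : finite_set S -> S !=set0 -> exists c0 s,
  [/\ S = [set` c0 :: s], uniq (c0 :: s) & num_of S = (size s).+1].
Proof.
move=> finS S0; have SE := fset_setK finS; rewrite /num_of.
have us := fset_uniq (fset_set S).
have SE' : S = [set` enum_fset (fset_set S)] by rewrite -{1}SE.
case: (enum_fset _) us SE' => [|c0 s] us SE'; last by exists c0, s.
by case: S0 => c; rewrite SE'.
Qed.

(** The cell is relatively open in [x + U], where [U] consists of the directions constant on [S] and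
    has dimension [d + 1 - num_of S]. *)
Lemma Voronoi_cell_dim C S : finite_set C -> S `<=` C -> S !=set0 ->
  aff_indep S -> Voronoi_cell C S !=set0 ->
  exists2 k, (k + num_of S)%N = d.+1 & has_dim (Voronoi_cell C S) k.
Proof.
move=> finC SC S0 iS [x xS].
have [c0 [s [SE us ->]]] := num_of_seq _ (sub_finite_set SC finC) S0.
have Sc0 : S c0 by rewrite SE /= mem_head.
have [w wP] := aff_indep_dual _ _ _ SE us iS.
have [U dU UP] := annihilator_dim _ (fun j => s`_j - c0) w wP.
have US v : v \in U <-> forall c, S c -> dotv v c = dotv v c0.
  split=> [/UP vs c|vS].
    rewrite SE /= inE => /orP[/eqP->//|cs].
    have := vs (index c s); rewrite index_mem nth_index // => /(_ cs).
    by rewrite dotvDr dotvNr => /eqP; rewrite subr_eq0 => /eqP.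
  apply/UP => j jl; rewrite dotvDr dotvNr vS ?subrr //.
  by rewrite SE /= inE mem_nth ?orbT.
exists (\dim U); first by rewrite addnS dU.
apply: (@has_dimI _ _ _ x) => // [z zS|u /US uS].
  apply/US => c Sc; have := @Voronoi_cell_diff C x z.
  by rewrite xS zS; apply.
have [eqS ltS] := (Voronoi_cellP C S c0 x SC Sc0).1 xS.
have [|l l0 lP] := @finite_dominated R _ (C `\` S)
    (fun c => sqdist x c0 - sqdist x c)
    (fun c => 2 * (dotv u c - dotv u c0)) (finite_setD _ finC).
  by move=> c [Cc nSc]; rewrite subr_gt0 ltS.
have l10 : 0 < l + 1 by rewrite ltr_wpDl.
(* The short step [(l + 1)^-1 *: u] stays in the cell, so [x + u] lies on the line through two
   points of the cell. *)
have -> : x + u = x + (l + 1) *: (x + (l + 1)^-1 *: u - x).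
  by rewrite [x + _^-1 *: u]addrC addrK scalerA divff ?gt_eqF // scale1r.
apply: affine_hull2 => //; apply/(Voronoi_cellP C S c0 _ SC Sc0); split=> c.
  by move=> Sc; rewrite !sqdistDZ (eqS c Sc) (uS c Sc).
move=> Cc nSc; rewrite !sqdistDZ -subr_gt0.
have := lP (l + 1) c; rewrite lerDl ler01 => /(_ isT (conj Cc nSc)).
rewrite -(pmulr_rgt0 _ (_ : 0 < (l + 1)^-1)) ?invr_gt0 //.
by rewrite mulrDr mulrA mulVf ?gt_eqF // mul1r; lra.
Qed.

(** Here [u] is an inner normal, opposite to the convention of [polytope_face]; this makes it a
    recession direction of the cell of [S]. *)
Definition exposed_by C S u b := [/\ u != 0, S = C `&` [set c | dotv u c = b]
  & forall c, C c -> b <= dotv u c].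

Definition exposed C S := exists u b, exposed_by C S u b.

Lemma exposed_by_lt {C S u b c} : exposed_by C S u b -> C c -> ~ S c -> b < dotv u c.
Proof.
move=> [_ -> bC] Cc nSc; rewrite lt_neqAle bC // andbT.
by apply/eqP => E; apply: nSc.
Qed.

Lemma exposed_sub {C S} : exposed C S -> S `<=` C.
Proof. by move=> [u [b [_ -> _]]]; exact: subIsetl. Qed.

Lemma exposed_cell_ray {C S u b x t} : exposed_by C S u b -> S !=set0 ->
  0 <= t -> Voronoi_cell C S x -> Voronoi_cell C S (x + t *: u).
Proof.
move=> eS [c0 Sc0] t0; have SC : S `<=` C by apply: exposed_sub; exists u, b.
have Sb c : S c -> dotv u c = b by case: eS => _ -> _ [].
move=> /(Voronoi_cellP C S c0 x SC Sc0)[eqS ltS].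
apply/(Voronoi_cellP C S c0 _ SC Sc0); split=> c.
  by move=> Sc; rewrite !sqdistDZ (eqS c Sc) (Sb c Sc) (Sb c0 Sc0).
move=> Cc nSc; have := ltS c Cc nSc.
have := ltW (exposed_by_lt eS Cc nSc); rewrite -subr_ge0 => /(mulr_ge0 t0).
by rewrite !sqdistDZ (Sb c0) //; lra.
Qed.

Lemma aff_indep_equidistant S c0 : finite_set S -> S c0 -> aff_indep S ->
  exists x, forall c, S c -> sqdist x c = sqdist x c0.
Proof.
move=> finS Sc0 iS; have [|c1 [s [SE us _]]] := num_of_seq S finS.
  by exists c0.
have [w wP] := aff_indep_dual _ _ _ SE us iS.
(* Equidistance from [c] and [c1] means [dotv x (c - c1) = a c], a linear system that the dual
   family solves. *)
pose a c := (dotv c c - dotv c1 c1) / 2.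
pose x := \sum_(i < size s) a s`_i *: w i.
suff xP c : S c -> sqdist x c = sqdist x c1.
  by exists x => c /xP->; rewrite xP.
have sqE c' : sqdist x c' = dotv x x - 2 * dotv x c' + dotv c' c'.
  by rewrite /sqdist dotvDl !dotvDr !dotvNl !dotvNr (dotvC c' x); lra.
rewrite SE /= inE => /orP[/eqP->//|/(nthP 0)[j jl <-]].
have : dotv x (s`_j - c1) = a s`_j.
  rewrite dotvC dotv_sumr (bigD1 (Ordinal jl)) //= big1 => [|i ij].
    by rewrite dotvZr dotvC wP // eqxx mulr1 addr0.
  by rewrite dotvZr dotvC wP // (negbTE (ij : val i != j)) mulr0.
by rewrite dotvDr dotvNr !sqE /a; lra.
Qed.

(** Far enough along [u] from a point equidistant from [S], the points of [S] are farther than all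
    others of [C]. *)
Lemma exposed_cell_nonempty C S : finite_set C -> S !=set0 -> aff_indep S ->
  exposed C S -> Voronoi_cell C S !=set0.
Proof.
move=> finC [c0 Sc0] iS eS; have SC := exposed_sub eS.
have [x xS] := aff_indep_equidistant S c0 (sub_finite_set SC finC) Sc0 iS.
case: eS => u [b eS]; have Sb c : S c -> dotv u c = b by case: eS => _ -> _ [].
have [|l _ lP] := @finite_dominated R _ (C `\` S)
    (fun c => 2 * (dotv u c - b)) (fun c => sqdist x c0 - sqdist x c)
    (finite_setD _ finC).
  by move=> c [Cc nSc]; rewrite mulr_gt0 // subr_gt0 (exposed_by_lt eS).
exists (x + l *: u); apply/(Voronoi_cellP C S c0 _ SC Sc0); split=> c.
  by move=> Sc; rewrite !sqdistDZ (xS c Sc) (Sb c Sc) (Sb c0 Sc0).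
move=> Cc nSc; have := lP l c (lexx l) (conj Cc nSc).
by rewrite !sqdistDZ (Sb c0) //; lra.
Qed.

(** Tilting a large multiple of [u] by the barycentric functional of [c] lifts [c] off the
    hyperplane, while the points outside [F] stay above it. *)
Lemma exposed_setD1 C F c : finite_set C -> exposed C F -> aff_indep F -> F c ->
  F `\ c !=set0 -> exposed C (F `\ c).
Proof.
move=> finC [u [b eF]] iF Fc [c1 [Fc1 c1c]].
have FC : F `<=` C by apply: exposed_sub; exists u, b.
have Fb a : F a -> dotv u a = b by case: eF => _ -> _ [].
have [w [be [wc wF]]] := iF c Fc.
have [|l _ lP] := @finite_dominated R _ (C `\` F)
    (fun a => dotv u a - b) (fun a => dotv w a - be) (finite_setD _ finC).
  by move=> a [Ca nFa]; rewrite subr_gt0 (exposed_by_lt eF).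
have uE a : dotv (l *: u + w) a = l * dotv u a + dotv w a.
  by rewrite dotvDl dotvZl.
have gt a : C a -> ~ (F `\ c) a -> l * b + be < dotv (l *: u + w) a.
  move=> Ca nFa; have [Fa|nFa'] := pselect (F a); last first.
    by have := lP l a (lexx l) (conj Ca nFa'); rewrite uE; lra.
  have -> : a = c by apply: contra_notP nFa => ac; split.
  by rewrite uE Fb // wc; lra.
have eq a : (F `\ c) a -> dotv (l *: u + w) a = l * b + be.
  by move=> [Fa ac]; rewrite uE Fb // wF.
exists (l *: u + w), (l * b + be); split.
- apply/eqP => u0; have := gt c (FC _ Fc) (fun H => H.2 erefl).
  by rewrite -(eq c1) // u0 !dot0v ltxx.
- apply/seteqP; split=> a; first by move=> Fa; split; [exact: FC Fa.1|exact: eq].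
  move=> [Ca /= aE]; apply: contrapT => /(gt a Ca).
  by rewrite aE ltxx.
- move=> a Ca; have [/eq->//|/(gt a Ca)/ltW//] := pselect ((F `\ c) a).
Qed.

Lemma aff_indep_sub S F : S `<=` F -> aff_indep F -> aff_indep S.
Proof.
move=> SF iF c /SF/iF[w [b [wc wF]]]; exists w, b; split=> // c' /SF.
exact: wF.
Qed.

Lemma exposed_subset C F S : finite_set C -> exposed C F -> aff_indep F ->
  S `<=` F -> S !=set0 -> exposed C S.
Proof.
move=> finC eF iF SF S0.
have /finite_seqP[l lE] := sub_finite_set (exposed_sub eF) finC.
have : forall c, F c -> S c \/ c \in l by move=> c; rewrite lE; right.
elim: l F eF iF SF {lE} => [|c l IHl] F eF iF SF Fl.
  suff -> : S = F by [].
  by apply/seteqP; split=> // c /Fl[].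
have [[Fc nSc]|H] := pselect (F c /\ ~ S c); last first.
  apply: (IHl F) => // a Fa; have [|] := Fl a Fa; first by left.
  rewrite inE => /orP[/eqP ac|]; last by right.
  by left; apply: contrapT => nSa; apply: H; rewrite -ac.
have SFc : S `<=` F `\ c.
  by move=> a Sa; split; [exact: SF|move=> /= ac; apply: nSc; rewrite -ac].
apply: (IHl (F `\ c)) => // [||a [Fa ac]].
- by apply: exposed_setD1 => //; case: S0 => a /SFc; exists a.
- by apply: aff_indep_sub iF; exact: subDsetl.
- have [|] := Fl a Fa; first by left.
  by rewrite inE => /orP[/eqP//|]; right.
Qed.

End VoronoiCells.

(** * Faces of the ball polyhedron and of its center-polytope *)

Section BasicBallPolyhedra.
Context {R : realType} {d : nat}.
Implicit Types (x y z u v w c : 'rV[R]_d) (t r b : R) (A C F S X : set 'rV[R]_d).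

Lemma exposed_cell_meets_bd C S r : finite_set C -> spanning C -> 0 < r ->
  (forall y, spanning (farthest C y) -> (ball_polyhedron C r)° y) ->
  exposed C S -> S !=set0 -> aff_indep S ->
  Voronoi_cell C S `&` bd (ball_polyhedron C r) !=set0.
Proof.
move=> finC spC r0 vtx eS S0 iS; have SC := exposed_sub eS.
have [y yS] := exposed_cell_nonempty C S finC S0 iS eS.
have [c0 Sc0] := S0; have cellP x := Voronoi_cellP C S c0 x SC Sc0.
(* A Voronoi vertex [x] whose farthest set contains [S] is interior to the ball polyhedron. A short
   step from [x] towards [y] stays there, and enters the cell: ties on [S] hold at both ends, and
   the other inequalities are weak at [x] and strict at [y]. *)
have [z [zS zP]] : exists z, Voronoi_cell C S z /\ ball_polyhedron C r z.
  have [|x xS spx] := farthest_spanning C y finC _ spC.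
    by exists c0; exact: SC.
  rewrite yS in xS; have [e e0 eP] := near_line (y - x) (vtx x spx).
  pose t := Num.min 1 (e / 2).
  have e20 : 0 < e / 2 by rewrite divr_gt0.
  have t0 : 0 < t by rewrite lt_min ltr01.
  have t1 : t <= 1 by rewrite ge_min lexx.
  have te : t < e.
    by rewrite (le_lt_trans (y := e / 2)) ?ge_min ?lexx ?orbT //; lra.
  exists (x + t *: (y - x)); split; last by apply: eP; rewrite ger0_norm ?ltW.
  have [eqS ltS] := (cellP y).1 yS; have xc0 := xS c0 Sc0.
  have yE c : sqdist y c =
      sqdist x c + 2 * (dotv (y - x) x - dotv (y - x) c) + dotv (y - x) (y - x).
    have := sqdistDZ x (y - x) c 1.
    by rewrite scale1r [x + (y - x)]addrC subrK expr1n mul1r mulr1.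
  apply/cellP; split=> c.
    move=> Sc; have := eqS c Sc; rewrite !sqdistDZ !yE.
    have -> := farthest_sqdist_eq (xS c Sc) xc0 => E.
    have -> : dotv (y - x) c = dotv (y - x) c0 by lra.
    by [].
  move=> Cc nSc; have := ltS c Cc nSc.
  have := ((farthestP C x c0).1 xc0).2 c Cc; rewrite -subr_ge0 => le lt.
  have h1 : 0 <= (1 - t) * (sqdist x c0 - sqdist x c).
    by rewrite mulr_ge0 // subr_ge0.
  have h2 : 0 < t * (sqdist y c0 - sqdist y c) by rewrite mulr_gt0 // subr_gt0.
  by move: h1 h2; rewrite !sqdistDZ !yE; lra.
case: eS => u [b eS]; have u0 : 0 < dotv u u by rewrite dotvv_gt0; case: eS.
(* Travel from [z] along the recession direction [u] up to the sphere of radius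
   [r] around [c0]; [t] is the larger root of the quadratic equation. *)
pose B := dotv u z - dotv u c0; pose D := sqdist z c0 - r ^+ 2.
have D0 : D <= 0.
  by rewrite subr_le0; apply: (ball_polyhedronP z r0).1 zP _ (SC _ Sc0).
pose q := Num.sqrt (B ^+ 2 - dotv u u * D).
have uD : 0 <= - (dotv u u * D) by rewrite -mulrN mulr_ge0 ?oppr_ge0 // ltW.
have q2 : q ^+ 2 = B ^+ 2 - dotv u u * D by rewrite sqr_sqrtr // addr_ge0 ?sqr_ge0.
have Bq : B <= q.
  rewrite (le_trans (ler_norm B)) // -sqrtr_sqr ler_sqrt ?lerDl //.
  by rewrite addr_ge0 ?sqr_ge0.
pose t := (q - B) / dotv u u.
have tu : t * dotv u u = q - B by rewrite mulfVK // gt_eqF.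
have t0 : 0 <= t by rewrite divr_ge0 ?subr_ge0 // ltW.
have pS := exposed_cell_ray eS S0 t0 zS.
have pr : sqdist (z + t *: u) c0 = r ^+ 2.
  have : dotv u u * (D + 2 * t * B + t ^+ 2 * dotv u u) = 0.
    have -> : dotv u u * (D + 2 * t * B + t ^+ 2 * dotv u u) =
      dotv u u * D + 2 * (t * dotv u u) * B + (t * dotv u u) ^+ 2 by ring.
    by rewrite tu; move: q2; nra.
  move=> /eqP; rewrite mulf_eq0 gt_eqF //= => /eqP.
  by rewrite sqdistDZ -/B /D; lra.
exists (z + t *: u); split=> //; split.
  apply: subset_closure; apply/(ball_polyhedronP _ r0) => c Cc; rewrite -pr.
  have [eqS ltS] := (cellP _).1 pS.
  by have [/eqS->//|nSc] := pselect (S c); exact: ltW (ltS c Cc nSc).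
by move=> /(interior_ball_polyhedron _ finC r0)/(_ c0 (SC _ Sc0)); rewrite pr ltxx.
Qed.

Lemma bd_farthest_sub_exposed C r x : finite_set C -> C !=set0 -> 0 < r ->
  (forall y, spanning (farthest C y) -> (ball_polyhedron C r)° y) ->
  bd (ball_polyhedron C r) x ->
  exists v b, exposed_by C (C `&` [set c | dotv v c = b]) v b /\
    farthest C x `<=` C `&` [set c | dotv v c = b].
Proof.
move=> finC C0 r0 vtx [_ nint].
have [||v v0 vP] := farthest_sub_argmin C r x finC C0.
- by move=> y /vtx/(interior_ball_polyhedron y finC r0).
- apply: contra_notP nint => H; apply/(interior_ball_polyhedron x finC r0) => c Cc.
  by rewrite ltNge; apply/negP => rc; apply: H; exists c.
have [c0 xc0] := farthest_nonempty C x finC C0.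
exists v, (dotv v c0); split.
  by split=> // c; exact: vP.
move=> c xc; split; first exact: xc.1.
by apply/eqP; rewrite eq_le !vP //; case: xc xc0 => ? _ [].
Qed.

(** A general position condition, asked of all hyperplanes, supporting or not. *)
Definition simplicial C := forall v b, v != 0 ->
  aff_indep (C `&` [set c | dotv v c = b]).

(* When [C] is simplicial, these are the vertex sets of the (d - k)-faces. *)
Definition exposed_simplices C k : set (set 'rV[R]_d) :=
  [set S | [/\ exposed C S, S !=set0 & (k + num_of S)%N = d.+1]].

Lemma finite_exposed_simplices C k : finite_set C -> finite_set (exposed_simplices C k).
Proof.
move=> finC; pose P := [set` fpowerset (fset_set C)].
apply: (@sub_finite_set _ _ [set [set` X] | X in P]).
  move=> S [/exposed_sub SC _ _]; have finS := sub_finite_set SC finC.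
  exists (fset_set S); last exact: fset_setK.
  rewrite /P /= fpowersetE; apply/fsubsetP => c.
  by rewrite !in_fset_set // !inE; exact: SC.
exact: finite_image (finite_fset _).
Qed.

Lemma num_of_image (T U : choiceType) (f : T -> U) (A : set T) :
  finite_set A -> (forall a a', A a -> A a' -> f a = f a' -> a = a') ->
  num_of (f @` A) = num_of A.
Proof.
move=> finA injf; rewrite /num_of fset_set_image // card_in_imfset //.
by move=> a a'; rewrite !in_fset_set // !inE; exact: injf.
Qed.

Lemma exposed_aff_indep C S : simplicial C -> exposed C S -> aff_indep S.
Proof. by move=> spC [u [b [u0 -> _]]]; exact: spC. Qed.

Lemma has_dim_nonempty X k : has_dim X k -> X !=set0.
Proof.
move=> [x [U [XU _]]]; have [m [p [a [Xp a1 _]]]] : affine_hull X x.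
  by rewrite XU; exists 0; rewrite /= ?mem0v ?addr0.
case: m p a Xp a1 => [|m] p a Xp; last by exists (p ord0).
by rewrite big_ord0 => /eqP; rewrite eq_sym oner_eq0.
Qed.

Lemma convex_hull_nonempty X : convex_hull X !=set0 -> X !=set0.
Proof.
move=> [x Xx]; apply/set0P/eqP => X0; move: x Xx.
by rewrite X0; apply: smallest_sub => // x y t; rewrite inE.
Qed.

(** The farthest set of a boundary point lies in an exposed, affinely independent set, hence is
    itself exposed; conversely, cells of exposed sets meet the boundary. The dimension of the cell
    then fixes the size of [S]. *)
Lemma ball_polyhedron_faces_exposed C r k : (1 <= k)%N -> finite_set C ->
  C !=set0 -> spanning C -> simplicial C -> 0 < r ->
  (forall y, spanning (farthest C y) -> (ball_polyhedron C r)° y) ->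
  ball_polyhedron_faces C r k.-1 =
  [set Voronoi_cell C S `&` bd (ball_polyhedron C r) | S in exposed_simplices C k].
Proof.
move=> k0 finC C0 spC siC r0 vtx; apply/seteqP; split=> F.
  move=> [V [[S [SC -> VS]] Vk -> [x [xS xbd]]]]; exists S => //.
  have [v [b [eF xF]]] := bd_farthest_sub_exposed C r x finC C0 r0 vtx xbd.
  have [c xc] := farthest_nonempty C x finC C0.
  rewrite xS in xF xc; have S0 : S !=set0 by exists c.
  have eS : exposed C S.
    apply: (exposed_subset _ _ _ finC _ _ xF S0); first by exists v, b.
    by apply: siC; case: eF.
  have [k' kS Vk'] := Voronoi_cell_dim C S finC SC S0 (exposed_aff_indep C S siC eS) VS.
  by split=> //; rewrite -kS (has_dim_inj _ _ _ Vk' Vk) prednK.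
move=> [S [eS S0 kS] <-]; have iS := exposed_aff_indep C S siC eS.
have [x xS] := exposed_cell_meets_bd C S r finC spC r0 vtx eS S0 iS.
have VS : Voronoi_cell C S !=set0 by exists x; case: xS.
have [k' k'S Vk'] := Voronoi_cell_dim C S finC (exposed_sub eS) S0 iS VS.
exists (Voronoi_cell C S); split=> //; last by exists x.
  by exists S; split=> //; exact: exposed_sub.
by rewrite prednK //; have -> : k = k' by lia.
Qed.

Lemma polytope_faces_exposed C k : (1 <= k <= d)%N -> finite_set C ->
  has_dim (convex_hull C) d -> simplicial C ->
  polytope_faces (convex_hull C) (d - k) =
  [set convex_hull S | S in exposed_simplices C k].
Proof.
move=> /andP[k1 kd] finC Cd siC; have dimS S : S `<=` C -> S !=set0 ->
    aff_indep S -> has_dim (convex_hull S) (num_of S).-1 /\ (0 < num_of S)%N.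
  move=> SC S0; have [c0 [s [-> us ->]]] := num_of_seq S (sub_finite_set SC finC) S0.
  by move=> iS; split=> //; exact: convex_hull_dim.
apply/seteqP; split=> F.
  move=> [[u [b [ub FE]]] Fk].
  have [x Fx] := has_dim_nonempty _ _ Fk.
  (* A zero normal would give all of [convex_hull C], of dimension [d] rather than [d - k]. *)
  have u0 : u != 0.
    apply/eqP => u0; have b0 : b = 0 by move: Fx; rewrite FE u0 => -[_ /=]; rewrite dot0v.
    have FC : F = convex_hull C.
      by rewrite FE u0 b0; apply/seteqP; split=> z; [case|split=> //=; rewrite dot0v].
    by rewrite FC in Fk; have := has_dim_inj _ _ _ Fk Cd; lia.
  pose S := C `&` [set c | dotv u c = b].
  have FS : F = convex_hull S.
    by rewrite FE convex_hull_face // => c Cc; apply: ub; exact: sub_gen_smallest.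
  have S0 : S !=set0 by apply: convex_hull_nonempty; rewrite -FS; exists x.
  have [|Sd Sn] := dimS S (@subIsetl _ _ _) S0; first exact: siC.
  exists S => //; split=> //; last first.
    by rewrite FS in Fk; have := has_dim_inj _ _ _ Fk Sd; lia.
  exists (- u), (- b); split; first by rewrite oppr_eq0.
    apply/seteqP; split=> c -[Cc /= cb]; split=> //=; move: cb; rewrite dotvNl.
      by move=> ->.
    exact: oppr_inj.
  by move=> c Cc; rewrite dotvNl lerN2; apply: ub; exact: sub_gen_smallest.
move=> [S [eS S0 kS] <-]; have iS := exposed_aff_indep C S siC eS.
have [Sd Sn] := dimS S (exposed_sub eS) S0 iS.
split; last by have -> : (d - k = (num_of S).-1)%N by lia.
have [u [b [u0 SE bC]]] := eS; have Cb c : C c -> dotv (- u) c <= - b.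
  by move=> Cc; rewrite dotvNl lerN2; exact: bC.
exists (- u), (- b); split; first exact: convex_hull_le.
rewrite convex_hull_face //; congr (convex_hull _); rewrite SE.
apply/seteqP; split=> c -[Cc /= cb]; split=> //=; move: cb; rewrite dotvNl.
  by move=> ->.
exact: oppr_inj.
Qed.

(** Both families are injective images of the finite set [exposed_simplices C k]. *)
Theorem simplicial_ball_polyhedron_faces C r k : (1 <= k <= d)%N ->
  simplicial C -> basic_ball_polyhedron C r ->
  [/\ finite_set (ball_polyhedron_faces C r k.-1),
      finite_set (polytope_faces (convex_hull C) (d - k))
    & num_of (ball_polyhedron_faces C r k.-1) =
      num_of (polytope_faces (convex_hull C) (d - k))].
Proof.
move=> kd siC [finC Cd _ [r0 _] vtx0]; have /andP[k1 _] := kd.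
have C0 : C !=set0 by apply: convex_hull_nonempty; exact: has_dim_nonempty Cd.
have spC := spanning_of_full_dim C Cd.
have vtx y : spanning (farthest C y) -> (ball_polyhedron C r)° y.
  move=> spy; apply: (vtx0 (Voronoi_cell C (farthest C y))) => //.
    by exists (farthest C y); split=> // [c []|]; last by exists y.
  exact: Voronoi_vertex_dim.
rewrite ball_polyhedron_faces_exposed // polytope_faces_exposed //.
have finS := finite_exposed_simplices C k finC.
split; [exact: finite_image|exact: finite_image|].
rewrite !num_of_image // => S S' [eS S0 _] [eS' S'0 _].
  (* For cells: [S] is recovered below as the farthest set of any point of its cell. For hulls: [S]
     is recovered here as the part of [C] in its hull. *)
  move=> E; have hull_sub T : exposed C T -> C `&` convex_hull T = T.
    move=> eT; apply/seteqP; split=> [c [Cc Tc]|c Tc]; last first.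
      by split; [exact: (exposed_sub eT)|exact: sub_gen_smallest].
    have [u [b [_ TE _]]] := eT; rewrite TE; split=> //.
    by apply: (convex_hull_eq T u b) Tc => a; rewrite TE => -[].
  by rewrite -(hull_sub S) // E hull_sub.
have [x xS] := exposed_cell_meets_bd C S r finC spC r0 vtx eS S0
  (exposed_aff_indep C S siC eS).
by move=> E; move: (xS); rewrite E => -[<- _]; case: xS.
Qed.

End BasicBallPolyhedra.

(* If [p] is the nonzero polynomial [dotv v (moment_curve t) - b], dividing out
   all factors [X - a] leaves a polynomial of degree at most [d] that vanishes
   at the other roots of [p] but not at [a]. *)
Lemma moment_curve_simplicial (R : realType) (d : nat) (C : set 'rV[R]_d) :
  C `<=` range (@moment_curve R d) -> simplicial C.
Proof.
move=> Cm v b v0 c [/Cm[a _ <-] /= ab].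
have eval (q : {poly R}) t : (size q <= d.+1)%N ->
    q.[t] = q`_0 + dotv (\row_(i < d) q`_i.+1) (moment_curve d t).
  move=> qd; rewrite (horner_coef_wide t qd) big_ord_recl expr0 mulr1.
  by congr (_ + _); apply: eq_bigr => i _; rewrite !mxE.
(* The sum has a single term, the coordinate of [v] with index [j]. *)
pose p : {poly R} := \poly_(i < d.+1)
  (if i is j.+1 then \sum_(l < d | l == j :> nat) v 0 l else - b).
have pv : \row_(i < d) p`_i.+1 = v.
  by apply/rowP => i; rewrite mxE coef_poly ltnS ltn_ord (big_pred1 i).
have p0 : p`_0 = - b by rewrite coef_poly.
have pE t : p.[t] = dotv v (moment_curve d t) - b.
  by rewrite eval ?size_poly // pv p0 addrC.
have pn0 : p != 0.
  by apply: contraNneq v0 => pn; rewrite -pv pn; apply/eqP/rowP => i; rewrite !mxE coef0.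
have [m [q]] := multiplicity_XsubC p a; rewrite pn0 /= => qa pq.
have qd : (size q <= d.+1)%N.
  apply: leq_trans (size_poly _ _ : (size p <= d.+1)%N).
  rewrite pq size_Mmonic ?monic_exp ?monicXsubC //; last first.
    by apply: contraNneq qa => ->; rewrite root0.
  by rewrite size_exp_XsubC addnS leq_addr.
(* This encodes [q / q.[a]], equal to 1 at [a] and 0 at the other roots of [p], with its constant
   term moved to [b]. *)
exists (q.[a]^-1 *: \row_(i < d) q`_i.+1), (- q`_0 / q.[a]); split.
  rewrite dotvZl; have := eval q a qd => /eqP; rewrite addrC -subr_eq => /eqP <-.
  by rewrite mulrBr mulVf // mulNr addrC [q`_0 / _]mulrC.
move=> c' [/Cm[a' _ <-] /= a'b] aa'.
have : p.[a'] = 0 by rewrite pE a'b subrr.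
rewrite pq hornerM horner_exp hornerXsubC => /eqP; rewrite mulf_eq0.
have a'a : a' - a != 0 by rewrite subr_eq0; apply: contra_notN aa' => /eqP->.
rewrite (negbTE (expf_neq0 _ a'a)) orbF => /eqP qa'.
rewrite dotvZl; have := eval q a' qd; rewrite qa' => /eqP.
by rewrite eq_sym addrC addr_eq0 => /eqP->; rewrite mulrC.
Qed.

Theorem mainTheorem2 (R : realType) (n d : nat) (hd : (3 <= d.+1)%N)
    (hn : (d.+1 <= n)%N) (C : set 'rV[R]_d)
    (hcard : (C #= `I_n)%card)
    (hmoment : C `<=` range (@moment_curve R d))
    (r : R) (hr : 0 < r) (hbasic : basic_ball_polyhedron C r) :
  forall k : nat, (1 <= k <= d)%N ->
    [/\ finite_set (ball_polyhedron_faces C r k.-1),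
        finite_set (polytope_faces (convex_hull C) (d - k))
      & num_of (ball_polyhedron_faces C r k.-1) =
        num_of (polytope_faces (convex_hull C) (d - k))].
Proof.
move=> k kd; apply: simplicial_ball_polyhedron_faces => //.
exact: moment_curve_simplicial.
Qed.
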